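(* Let $C$ be a nonempty closed convex subset of a real Hilbert space $\mathcal{H}$, and let $f : C\times C\to\mathbb{R}$, $f(x,y)=\phi(x,y)+\varphi(y)-\varphi(x)$, where $\phi:C\times C\to\mathbb{R}$ is such that $\phi(x,\cdot)$ is convex for every $x\in C$ and $\varphi:C\to\mathbb{R}$ is convex. Suppose that $f$ is strongly monotone on $C$ with modulus $\tau>0$ and satisfies the Lipschitz-type condition on $C$ with constants $L_1,L_2>0$ satisfying $L_1+L_2>\tau$. Then the proximal mapping $B_\lambda$ is quasicontractive on $C$, namely $$\|B_\lambda(x)-x^*\|\le\sqrt{\alpha}\,\|x-x^*\|\qquad\text{for all } x\in C \text{ and all } x^*\in\mathrm{Fix}(B_\lambda),$$ whenever $\lambda\in\left(0,\frac{1}{2L_2}\right)$, where $\alpha:=1-2\lambda(\tau-L_1)>0$.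
   Context: $\langle\cdot,\cdot\rangle$ and $\|\cdot\|$ denote the inner product and induced norm of $\mathcal{H}$. For $\lambda>0$ and $x\in C$, the proximal mapping $B_\lambda$ assigns to $x$ the unique minimizer $$B_\lambda(x):=\operatorname{argmin}\left\{\lambda f(x,y)+\tfrac12\|y-x\|^2 : y\in C\right\},$$ and $\mathrm{Fix}(B_\lambda)=\{x\in C: B_\lambda(x)=x\}$ is its set of fixed points. Standing assumption: either $C$ has an interior point or, for every $x\in C$, $\phi(x,\cdot)$ is continuous with respect to $C$ at some point of $C$. A mapping $T$ with values in $C$ is quasicontractive on $C$ if there exists $\rho$ with $0<\rho<1$ such that $\|T(x)-T(y)\|\le\rho\|x-y\|$ for all $x\in\mathrm{Fix}(T)$ and all $y\in C$. $f$ is strongly monotone on $C$ with modulus $\tau>0$ if $f(x,y)+f(y,x)\le-\tau\|x-y\|^2$ for all $x,y\in C$. $f$ satisfies the Lipschitz-type condition on $C$ with constants $L_1,L_2>0$ if $f(u,v)+f(v,w)\ge f(u,w)-L_1\|u-v\|^2-L_2\|v-w\|^2$ for all $u,v,w\in C$.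
   Formalization: The inequality and α>0 are proved as stated, but quasicontractivity (ρ<1) is asserted only when α<1, i.e. L₁<τ; otherwise it can fail: on R², φ(x,y)=⟨Ax,y−x⟩, A=I+3J (J rotation by π/2), φ-term ϕ=0, τ=1, L₁=5, L₂=1/2, λ=1/2. *)

(* Defs.v *)
From HB Require Import structures.
From mathcomp Require Import all_boot all_order all_algebra.
From mathcomp Require Import all_classical all_reals all_analysis.
Set Implicit Arguments.
Unset Strict Implicit.
Unset Printing Implicit Defensive.
Import Order.TTheory GRing.Theory Num.Theory.
Import numFieldNormedType.Exports.
Local Open Scope classical_set_scope.
Local Open Scope ring_scope.

(* A function defined on [C] (or on [C * C]) is represented by a total function
   on [H]; every notion below only looks at its values at points of [C]. *)

(* The norm of the complete normed module [H] is the one induced by the inner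
   product [dot]; together they make [H] a real Hilbert space. *)
Definition norm_induced_by (R : realType) (H : completeNormedModType R)
    (dot : {dot H for idfun}) : Prop :=
  forall u : H, `|u| = Num.sqrt (dot u u).

Definition bifunction (R : realType) (H : completeNormedModType R)
    (phi : H -> H -> R) (vphi : H -> R) (x y : H) : R :=
  phi x y + vphi y - vphi x.

Definition strongly_monotone (R : realType) (H : completeNormedModType R)
    (C : set H) (f : H -> H -> R) (tau : R) : Prop :=
  forall x y : H, C x -> C y -> f x y + f y x <= - tau * `|x - y| ^+ 2.

Definition lipschitz_type (R : realType) (H : completeNormedModType R)
    (C : set H) (f : H -> H -> R) (L1 L2 : R) : Prop :=
  forall u v w : H, C u -> C v -> C w ->
    f u v + f v w >= f u w - L1 * `|u - v| ^+ 2 - L2 * `|v - w| ^+ 2.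

Definition continuous_wrt_at (R : realType) (H : completeNormedModType R)
    (C : set H) (g : H -> R) (y : H) : Prop :=
  g z @[z --> within C (nbhs y)] --> g y.

Definition argmin (R : realType) (H : completeNormedModType R)
    (C : set H) (g : H -> R) : set H :=
  [set p | C p /\ forall y, C y -> g p <= g y].

(* Lower semicontinuity of [f x] is not assumed, so a minimizer need not exist
   for arbitrary data: that each [x] in [C] has a (unique) minimizer is what it
   means for the proximal mapping to be a mapping on [C]. *)
Definition is_proximal_mapping (R : realType) (H : completeNormedModType R)
    (C : set H) (f : H -> H -> R) (lam : R) (B : H -> H) : Prop :=
  forall x : H, C x ->
    argmin C (fun y => lam * f x y + 2^-1 * `|y - x| ^+ 2) = [set B x].

Definition Fix (R : realType) (H : completeNormedModType R)
    (C : set H) (T : H -> H) : set H :=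
  [set x | C x /\ T x = x].

Definition quasicontractive (R : realType) (H : completeNormedModType R)
    (C : set H) (T : H -> H) : Prop :=
  exists rho : R, [/\ 0 < rho, rho < 1 &
    forall x y : H, Fix C T x -> C y -> `|T x - T y| <= rho * `|x - y|].

(* Main.v *)
Require Import Defs.
From HB Require Import structures.
From mathcomp Require Import all_boot all_order all_algebra.
From mathcomp Require Import all_classical all_reals all_analysis.
From mathcomp Require Import ring lra.
Set Implicit Arguments.
Unset Strict Implicit.
Unset Printing Implicit Defensive.
Import Order.TTheory GRing.Theory Num.Theory.
Import numFieldNormedType.Exports.
Local Open Scope classical_set_scope.
Local Open Scope ring_scope.

(** Write [f] for the bifunction, [z := B x] and let [xs] be a fixed point of
    [B].  The objective of the proximal problem is convex plus
    [2^-1 * `|y - x| ^+ 2], so its minimizer does not merely beat any other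
    point [y] of [C]: it beats it by [2^-1 * `|y - z| ^+ 2]
    ([argmin_prox_three_points]).  This is used twice.

    With [x = z = xs] the quadratic terms cancel, and it says that [f xs] is
    minimal over [C] at [xs]; since the Lipschitz-type condition forces
    [0 <= f u u], the fixed point solves the equilibrium problem:
    [0 <= f xs y] for all [y] in [C] ([prox_fixpoint_equilibrium]).

    With a general [x] and [y = xs] it gives
    [`|z - xs| ^+ 2 + `|x - z| ^+ 2 - `|x - xs| ^+ 2
       <= 2 * lam * (f x xs - f x z)].
    Strong monotonicity on the pair [(x, xs)] and the Lipschitz-type condition
    on the triple [(xs, x, z)], in which [f xs z] is dropped because it is
    nonnegative, bound the difference [f x xs - f x z] by
    [(L1 - tau) * `|x - xs| ^+ 2 + L2 * `|x - z| ^+ 2].  Altogether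
    [`|z - xs| ^+ 2
       <= alpha * `|x - xs| ^+ 2 - (1 - 2 * lam * L2) * `|x - z| ^+ 2],
    and [lam < 1 / (2 * L2)] makes the last term harmless
    ([prox_sqr_dist_le]).  The same bound on [lam] gives [0 < alpha], since
    [2 * lam * (tau - L1) < 2 * lam * L2 < 1] when [tau < L1 + L2]. *)

Section inner_product_norm.
Context (R : realType) (H : completeNormedModType R).
Context (dot : {dot H for idfun}) (Hdot : norm_induced_by dot).

Lemma dot_sqr_norm (u : H) : dot u u = `|u| ^+ 2.
Proof.
rewrite Hdot sqr_sqrtr //; have [->|u0] := eqVneq u 0; first by rewrite linear0r.
exact/ltW/neq0_dnorm_gt0.
Qed.

Lemma sqr_norm_conv (t : R) (a b : H) :
  `|t *: a + (1 - t) *: b| ^+ 2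
    = t * `|a| ^+ 2 + (1 - t) * `|b| ^+ 2 - t * (1 - t) * `|a - b| ^+ 2.
Proof.
rewrite -!dot_sqr_norm (hnormB dot) (hnormD dot) /=.
rewrite !(linearZl_LR, linearZr_LR) /=.
by rewrite !expr0 !mul1r /GRing.scale /=; ring.
Qed.

(** The minimizer is compared with the points [t *: y + (1 - t) *: z] of the
    segment from [z] to [y].  By [sqr_norm_conv] the quadratic term is convex
    along it with the defect [t * (1 - t) * 2^-1 * `|y - z| ^+ 2]; dividing by
    [t] and letting [t] tend to [0] turns the defect into the gain stated. *)
Lemma argmin_prox_three_points (C : set H) (h : H -> R) (lam : R) (x z y : H) :
    convex_set C -> convex_function C h -> 0 <= lam ->
    argmin C (fun w => lam * h w + 2^-1 * `|w - x| ^+ 2) z -> C y ->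
  lam * h z + 2^-1 * `|z - x| ^+ 2 + 2^-1 * `|y - z| ^+ 2
    <= lam * h y + 2^-1 * `|y - x| ^+ 2.
Proof.
move=> Cconv hconv lam0 [Cz zmin] Cy.
set D := lam * h y + 2^-1 * `|y - x| ^+ 2 - (lam * h z + 2^-1 * `|z - x| ^+ 2).
suff: 2^-1 * `|y - z| ^+ 2 <= D by rewrite /D; lra.
have gain t : 0 < t -> t <= 1 -> (1 - t) * (2^-1 * `|y - z| ^+ 2) <= D.
  move=> t0 t1; have t01 : Itv.spec (@Itv.num_sem R) (Itv.Real `[0, 1]%Z) t.
    by rewrite /= /Itv.num_sem /= in_itv /= num_real ltW.
  have yC : y \in C by rewrite inE.
  have zC : z \in C by rewrite inE.
  have Cw : C (t *: y + (1 - t) *: z).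
    by have := Cconv y z (Itv.mk t01) yC zC; rewrite inE.
  have hle : h (t *: y + (1 - t) *: z) <= t * h y + (1 - t) * h z.
    exact: hconv (Itv.mk t01) y z yC zC.
  have := zmin _ Cw.
  have -> : t *: y + (1 - t) *: z - x = t *: (y - x) + (1 - t) *: (z - x).
    rewrite !scalerBr addrACA -opprD -scalerDl.
    by rewrite (addrC t) subrK scale1r.
  rewrite sqr_norm_conv.
  have -> : y - x - (z - x) = y - z by rewrite opprB addrA subrK.
  move=> zle; rewrite -(ler_pM2l t0).
  have := ler_wpM2l lam0 hle; rewrite /D; lra.
apply/ler_addgt0Pr => e e0.
set N := 2^-1 * _ in gain *.
have N0 : 0 <= N by rewrite mulr_ge0 ?exprn_ge0 // invr_ge0.
(* Any [t] in ]0, 1] with [t * N <= e] will do; dividing by [N + e] rather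
   than by [N] covers [N = 0] and ensures [t <= 1]. *)
have Ne : 0 < N + e by rewrite ltr_wpDl.
have t0 : 0 < e / (N + e) by rewrite divr_gt0.
have t1 : e / (N + e) <= 1 by rewrite ler_pdivrMr // mul1r lerDr.
have := gain _ t0 t1; have : e / (N + e) * N <= e.
  by rewrite mulrAC ler_pdivrMr // ler_pM2l // lerDl ltW.
lra.
Qed.

End inner_product_norm.

Section equilibrium.
Context (R : realType) (H : completeNormedModType R).
Implicit Types (C : set H) (f : H -> H -> R).

Lemma bifunction_convex C (phi : H -> H -> R) (vphi : H -> R) x :
    convex_function C (phi x) -> convex_function C vphi ->
  convex_function C (bifunction phi vphi x).
Proof.
move=> phic vphic t a b aC bC; have := phic t a b aC bC.
have := vphic t a b aC bC.
rewrite /bifunction !convRE /unstable.onem; lra.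
Qed.

Lemma lipschitz_type_diag_ge0 C f L1 L2 u :
  lipschitz_type C f L1 L2 -> C u -> 0 <= f u u.
Proof.
move=> fL Cu; have := fL u u u Cu Cu Cu.
by rewrite subrr normr0 expr0n /=; lra.
Qed.

Context (dot : {dot H for idfun}) (Hdot : norm_induced_by dot).
Context (C : set H) (Cconvex : convex_set C).
Context (f : H -> H -> R) (f_convex : forall x, C x -> convex_function C (f x)).
Context (L1 L2 : R) (f_lipschitz : lipschitz_type C f L1 L2).
Context (lam : R) (lam_gt0 : 0 < lam) (B : H -> H).
Context (B_prox : is_proximal_mapping C f lam B).

Lemma prox_argmin x : C x ->
  argmin C (fun y => lam * f x y + 2^-1 * `|y - x| ^+ 2) (B x).
Proof. by move=> Cx; rewrite B_prox. Qed.

(** At a fixed point the center and the minimizer coincide, so the quadratic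
    terms cancel from the three-point inequality and [xs] minimizes [f xs] itself;
    its minimum is nonnegative because [f] is so on the diagonal. *)
Lemma prox_fixpoint_equilibrium xs y : Fix C B xs -> C y -> 0 <= f xs y.
Proof.
move=> [Cxs Bxs] Cy; apply: le_trans (lipschitz_type_diag_ge0 f_lipschitz Cxs) _.
have := argmin_prox_three_points Hdot Cconvex (f_convex Cxs) (ltW lam_gt0)
  (prox_argmin Cxs) Cy.
by rewrite Bxs subrr normr0 expr0n /= mulr0 addr0 lerD2r ler_pM2l.
Qed.

(** The Lipschitz-type condition is applied with [xs] first and [x] in the
    middle: [L1] then multiplies [`|x - xs| ^+ 2], where it competes with [tau],
    and [L2] multiplies [`|x - B x| ^+ 2], which the three-point inequality
    absorbs as soon as [2 * lam * L2 <= 1]. *)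
Lemma prox_sqr_dist_le tau x xs :
    strongly_monotone C f tau -> 2 * lam * L2 <= 1 -> C x -> Fix C B xs ->
  `|B x - xs| ^+ 2 <= (1 - 2 * lam * (tau - L1)) * `|x - xs| ^+ 2.
Proof.
move=> fmono lamL2 Cx Fxs; have [Cxs _] := Fxs.
have Bx := prox_argmin Cx; have CBx := Bx.1.
have prox3 := argmin_prox_three_points Hdot Cconvex (f_convex Cx) (ltW lam_gt0)
  Bx Cxs.
have fxsBx := prox_fixpoint_equilibrium Fxs CBx.
have lip := f_lipschitz Cxs Cx CBx.
have mono := fmono _ _ Cx Cxs.
rewrite (distrC (B x) x) (distrC xs x) (distrC xs (B x)) in prox3 lip.
have fdiff : f x xs - f x (B x) <=
    (L1 - tau) * `|x - xs| ^+ 2 + L2 * `|x - B x| ^+ 2 by lra.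
have := ler_wpM2l (ltW lam_gt0) fdiff.
have : 2 * lam * L2 * `|x - B x| ^+ 2 <= 1 * `|x - B x| ^+ 2.
  by rewrite ler_wpM2r ?exprn_ge0.
lra.
Qed.

End equilibrium.

Theorem theorem1 (R : realType) (H : completeNormedModType R)
    (dot : {dot H for idfun}) (Hdot : norm_induced_by dot)
    (C : set H) (C0 : C !=set0) (Cclosed : closed C) (Cconvex : convex_set C)
    (phi : H -> H -> R) (vphi : H -> R)
    (phi_convex : forall x, C x -> convex_function C (phi x))
    (vphi_convex : convex_function C vphi)
    (standing : C° !=set0 \/
       forall x, C x -> exists2 y, C y & continuous_wrt_at C (phi x) y)
    (tau L1 L2 : R) (tau_gt0 : 0 < tau) (L1_gt0 : 0 < L1) (L2_gt0 : 0 < L2)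
    (f_monotone : strongly_monotone C (bifunction phi vphi) tau)
    (f_lipschitz : lipschitz_type C (bifunction phi vphi) L1 L2)
    (L12 : L1 + L2 > tau)
    (lam : R) (lam_gt0 : 0 < lam) (lam_lt : lam < 1 / (2 * L2))
    (B : H -> H)
    (B_prox : is_proximal_mapping C (bifunction phi vphi) lam B) :
  let alpha := 1 - 2 * lam * (tau - L1) in
  [/\ 0 < alpha,
      forall x xs : H, C x -> Fix C B xs ->
        `|B x - xs| <= Num.sqrt alpha * `|x - xs|
    & alpha < 1 -> quasicontractive C B].
Proof.
move=> alpha.
have lamL2 : 2 * lam * L2 < 1.
  by move: lam_lt; rewrite ltr_pdivlMr ?mulr_gt0 //; lra.
have alpha_gt0 : 0 < alpha.
  have : lam * (tau - L1) < lam * L2 by rewrite ltr_pM2l // ltrBlDl.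
  by rewrite /alpha; lra.
have f_convex x : C x -> convex_function C (bifunction phi vphi x).
  by move=> Cx; apply: bifunction_convex => //; exact: phi_convex.
have contr x xs : C x -> Fix C B xs ->
    `|B x - xs| <= Num.sqrt alpha * `|x - xs|.
  move=> Cx Fxs; rewrite -(@ler_pXn2r _ 2) ?nnegrE ?mulr_ge0 ?sqrtr_ge0 //.
  rewrite exprMn sqr_sqrtr ?(ltW alpha_gt0) //.
  exact: (prox_sqr_dist_le Hdot Cconvex f_convex f_lipschitz lam_gt0 B_prox
    f_monotone (ltW lamL2)).
split=> // alpha_lt1; exists (Num.sqrt alpha); split=> [| |xs y Fxs Cy].
- by rewrite sqrtr_gt0.
- by rewrite -[ltRHS]sqrtr1 ltr_sqrt.
- by case: (Fxs) => _ ->; rewrite distrC (distrC xs); exact: contr.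
Qed.
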